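(* Let $d\ge 1$, $\sigma\ge 2$, $\mathcal I=\mathbb R_{>0}$, and let $f:\mathbb R^d\to\mathbb R$ be smooth. Zhang's equation $$\ddot x+\frac{2\sigma+1}{t}\,\dot x+\sigma^2t^{\sigma-2}\,\nabla f(x)=0,\qquad x\in\mathbb R^d,\ t\in\mathcal I,$$ is expressed as a non-autonomous Hamiltonian system. That is, there is a smooth function $H$ on the part $\{p_0\neq0\}$ of $\mathbb R^{2d+2}\times\mathcal I$, with coordinates $(q^0,\dots,q^d,p_0,\dots,p_d,t)$, such that the curves $x(t)$ solving Zhang's equation are exactly the components $(q^1(t),\dots,q^d(t))$ of solutions of the canonical equations of motion of $H$.
   Context: A dot denotes $d/dt$. The canonical equations of motion of a (non-autonomous) Hamiltonian $H(q^0,\dots,q^d,p_0,\dots,p_d,t)$ are $\dot q^a=\partial H/\partial p_a$, $\dot p_a=-\partial H/\partial q^a$ for $a=0,\dots,d$ (and $\dot t=1$). *)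

(* Defs.v *)
From mathcomp Require Import all_boot all_order all_algebra.
From mathcomp Require Import all_classical all_reals all_analysis.

Set Implicit Arguments.
Unset Strict Implicit.
Unset Printing Implicit Defensive.

Import Order.TTheory GRing.Theory Num.Theory.
Import numFieldNormedType.Exports.

Local Open Scope ring_scope.
Local Open Scope classical_set_scope.

(* C^k on an open set [U] of a finite-dimensional space [V]; in finite
   dimension, continuity of the Frechet derivative amounts to continuity of
   all the directional derivatives. *)
Fixpoint Ck_on (R : realType) (V : normedModType R) (k : nat) (U : set V)
    (f : V -> R) : Prop :=
  match k with
  | 0 => forall x, U x -> {for x, continuous f}
  | k'.+1 => (forall x, U x -> differentiable f x) /\
             (forall v : V, Ck_on k' U ('D_v f))
  end.

Definition smooth_on (R : realType) (V : normedModType R) (U : set V)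
    (f : V -> R) : Prop :=
  forall k, Ck_on k U f.

Definition grad (R : realType) (d : nat) (f : 'rV[R]_d -> R) (x : 'rV[R]_d) :
    'rV[R]_d :=
  \row_(i < d) 'D_(delta_mx 0 i) f x.

Definition time_interval (R : realType) (J : set R) : Prop :=
  [/\ open J, is_interval J & J `<=` [set t | 0 < t]].

Definition zhang_solution (R : realType) (d : nat) (sigma : R)
    (f : 'rV[R]_d -> R) (J : set R) (x : R -> 'rV[R]_d) : Prop :=
  forall t, J t ->
    [/\ derivable x t 1, derivable (derive1 x) t 1 &
        derive1 (derive1 x) t + ((2 * sigma + 1) / t) *: derive1 x t
          + (sigma ^+ 2 * t `^ (sigma - 2)) *: grad f (x t) = 0].

(* Points are ((q, p), t), with q = (q^0, ..., q^d) and p = (p_0, ..., p_d). *)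
Notation ext_phase_space R d := ('rV[R]_d.+1 * 'rV[R]_d.+1 * R)%type.

Definition ham_domain (R : realType) (d : nat) : set (ext_phase_space R d) :=
  [set z : ext_phase_space R d | (z.1.2 0 ord0 != 0) /\ (0 < z.2)].

Definition dHdq (R : realType) (d : nat) (H : ext_phase_space R d -> R)
    (a : 'I_d.+1) (z : ext_phase_space R d) : R :=
  'D_(delta_mx 0 a, 0, 0) H z.

Definition dHdp (R : realType) (d : nat) (H : ext_phase_space R d -> R)
    (a : 'I_d.+1) (z : ext_phase_space R d) : R :=
  'D_(0, delta_mx 0 a, 0) H z.

Definition canonical_solution (R : realType) (d : nat)
    (H : ext_phase_space R d -> R) (J : set R) (q p : R -> 'rV[R]_d.+1) : Prop :=
  forall t, J t ->
    [/\ ham_domain (q t, p t, t), derivable q t 1, derivable p t 1 &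
        forall a : 'I_d.+1,
          derive1 q t 0 a = dHdp H a (q t, p t, t) /\
          derive1 p t 0 a = - dHdq H a (q t, p t, t)].

(* Main.v *)
(** Multiplied by [t^(2 sigma + 1)], Zhang's equation is the Euler-Lagrange
    equation of [t^(2 sigma + 1) |x'|^2 / 2 - sigma^2 t^(3 sigma - 1) f x].
    The Legendre transform, with [p = t^(2 sigma + 1) x'], gives
    [H = t^-(2 sigma + 1) |p|^2 / 2 + sigma^2 t^(3 sigma - 1) f q], where only
    the coordinates of index at least 1 enter. Then [q^0] and [p_0] are
    constants of motion, and [p_0 = 1] keeps the solution inside the domain. *)

Require Import Defs.
From HB Require Import structures.
From mathcomp Require Import all_boot all_order all_algebra.
From mathcomp Require Import all_classical all_reals all_analysis.
From mathcomp Require Import ring.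

Set Implicit Arguments.
Unset Strict Implicit.
Unset Printing Implicit Defensive.

Import Order.TTheory GRing.Theory Num.Theory.
Import numFieldNormedType.Exports.
Local Open Scope ring_scope.
Local Open Scope classical_set_scope.

(** * Locality of differentiability *)

Lemma near_eq_open {R : realType} {V : normedModType R} {T : Type}
    (U : set V) (f g : V -> T) :
  open U -> (forall x, U x -> f x = g x) ->
  forall x, U x -> {near x, f =1 g}.
Proof.
move=> oU fg x Ux; have := open_nbhs_nbhs (conj oU Ux).
by apply: filterS => y /fg.
Qed.

(** The first-order expansion of [f] at [x] is also one of [g], since it only involves values near
    [x]; uniqueness of the differential then gives ['d g x = 'd f x]. *)
Lemma near_eq_differentiable {R : realType} {V W : normedModType R}
    (f g : V -> W) (x : V) :
  {near x, f =1 g} -> differentiable f x -> differentiable g x.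
Proof.
move=> fg /diff_locallyP[dfc fE].
have gE : g \o shift x = cst (g x) + 'd f x +o_ 0 id.
  apply/eqaddoP => e e0; move/eqaddoP: fE => /(_ e e0).
  have : \forall y \near (0 : V), f (y + x) = g (y + x).
    by move: fg; rewrite (near_shift 0 x) /= subr0.
  apply: filterS2 => y fgy; rewrite !fctE /= fgy.
  by rewrite (nbhs_singleton fg).
have dgE := diff_unique dfc gE.
by apply/diff_locallyP; rewrite dgE.
Qed.

(** * Closure properties of the class C^k on an open set *)

Section Ck.
Context {R : realType} {V : normedModType R} (U : set V).
Hypothesis oU : open U.
Implicit Types f g : V -> R.

(** As [U] is open, agreement on [U] is agreement near each of its points, hence passes to all
    directional derivatives. This lets the lemmas below replace a derivative by its formula valid on
    [U] only. *)
Lemma eq_Ck_on k f g : (forall x, U x -> f x = g x) ->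
  Ck_on k U f -> Ck_on k U g.
Proof.
elim: k f g => [|k IH] f g fg /= fk.
  move=> x Ux; have fgx := near_eq_open oU fg Ux.
  suff : g @ x --> g x by [].
  by rewrite -fg//; exact: cvg_trans (near_eq_cvg fgx) (fk x Ux).
case: fk => df fk; split=> [x Ux|v].
  exact: near_eq_differentiable (near_eq_open oU fg Ux) (df x Ux).
apply: IH (fk v) => x Ux; exact: near_eq_derive (near_eq_open oU fg Ux).
Qed.

Lemma Ck_onS k f : Ck_on k.+1 U f -> Ck_on k U f.
Proof.
elim: k f => [|k IH] f [df fk]; last by split=> // v; exact: IH.
by move=> x Ux; exact/differentiable_continuous/df.
Qed.

Lemma Ck_on_cst k (c : R) : Ck_on k U (cst c).
Proof.
elim: k c => [|k IH] c; first by move=> x _; exact: cst_continuous.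
split=> [x _|v]; first exact: differentiable_cst.
by apply: eq_Ck_on (IH 0) => x _; rewrite derive_cst.
Qed.

Lemma Ck_onD k f g : Ck_on k U f -> Ck_on k U g -> Ck_on k U (f + g).
Proof.
elim: k f g => [|k IH] f g.
  by move=> fk gk x Ux; apply: continuousD; [exact: fk|exact: gk].
move=> [df fk] [dg gk]; split=> [x Ux|v].
  by apply: differentiableD; [exact: df|exact: dg].
apply: eq_Ck_on (IH _ _ (fk v) (gk v)) => x Ux.
by rewrite deriveD//; apply: diff_derivable; [exact: df|exact: dg].
Qed.

(** By the Leibniz rule the derivative also involves [f] and [g] themselves, which [Ck_onS] brings
    down to order [k]. *)
Lemma Ck_onM k f g : Ck_on k U f -> Ck_on k U g -> Ck_on k U (f * g).
Proof.
elim: k f g => [|k IH] f g.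
  by move=> fk gk x Ux; apply: continuousM; [exact: fk|exact: gk].
move=> fS gS; have [[df fk] [dg gk]] := (fS, gS); split=> [x Ux|v].
  by apply: differentiableM; [exact: df|exact: dg].
have := Ck_onD (IH _ _ (Ck_onS fS) (gk v)) (IH _ _ (Ck_onS gS) (fk v)).
apply: eq_Ck_on => x Ux.
by rewrite deriveM//; apply: diff_derivable; [exact: df|exact: dg].
Qed.

Lemma Ck_on_sum k n (h : 'I_n -> V -> R) :
  (forall i, Ck_on k U (h i)) -> Ck_on k U (\sum_(i < n) h i).
Proof.
move=> hk; elim/big_ind: _ => //; last exact: Ck_onD.
exact: Ck_on_cst.
Qed.

End Ck.

(** * Composition with continuous linear maps *)

Section comp_linear.
Context {R : realType} {V W : normedModType R} (L : V -> W).
Hypotheses (linL : linear L) (cL : continuous L).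

Lemma is_diff_linear x : is_diff x L L.
Proof.
(* [L] is a bare function, so its linear structure is packed locally. *)
pose LM := GRing.isLinear.Build _ _ _ _ _ linL.
pose LL : {linear _ -> _} := HB.pack L LM.
have -> : L = LL by [].
apply: DiffDef; first exact: linear_differentiable.
by rewrite diff_lin.
Qed.

Lemma is_derive_comp_linear (f : W -> R) x v : differentiable f (L x) ->
  is_derive x v (f \o L) ('D_(L v) f (L x)).
Proof.
move=> df; have dL := is_diff_linear x.
have dfL : differentiable (f \o L) x by exact: differentiable_comp.
split; first exact: diff_derivable.
by rewrite !deriveE// diff_comp//= diff_val.
Qed.

(** The derivative of [f \o L] along [v] is ['D_(L v) f \o L], with a direction [L v] that does not
    depend on the point: it is again a composite with [L], so the induction closes. *)
Lemma Ck_on_comp_linear (U : set V) (U' : set W) k (f : W -> R) :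
  open U -> (forall x, U x -> U' (L x)) -> Ck_on k U' f -> Ck_on k U (f \o L).
Proof.
move=> oU UU'; elim: k f => [|k IH] f.
  by move=> fk x /UU' Ux; apply: continuous_comp; [exact: cL|exact: fk].
move=> [df fk]; split=> [x Ux|v].
  have dL := is_diff_linear x.
  by apply: differentiable_comp => //; apply: df; exact: UU'.
apply: eq_Ck_on (IH _ (fk (L v))) => // x Ux.
by have [_ ->] := is_derive_comp_linear v (df _ (UU' _ Ux)).
Qed.

Lemma is_derive_linear x v : is_derive x v L (L v).
Proof.
have dL := is_diff_linear x; split; first exact: diff_derivable.
by rewrite deriveE// diff_val.
Qed.

End comp_linear.

(** * Smoothness of the identity and of real powers *)

Lemma Ck_on_id {R : realType} k : Ck_on k [set: R] (@idfun R).
Proof.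
elim: k => [|k _] //=; first by move=> x _.
split=> // v; apply: (@eq_Ck_on R R _ openT _ (cst v)); last first.
  exact: Ck_on_cst openT _ _.
by move=> x _; rewrite derive_id.
Qed.

(** The derivative is a constant times a power with exponent [a - 1], so the induction on the order
    runs over all exponents at once. *)
Lemma smooth_on_powR {R : realType} (a : R) :
  smooth_on [set t : R | 0 < t] (fun t => t `^ a).
Proof.
move=> k; have oU := @open_gt R 0; elim: k a => [|k IH] a.
  move=> t t0; apply/differentiable_continuous/derivable1_diffP.
  by apply: derivable_powR; rewrite in_itv/= andbT.
have df (t : R) : 0 < t -> differentiable (fun t : R => t `^ a) t.
  by move=> t0; apply/derivable1_diffP/derivable_powR; rewrite in_itv/= andbT.
split=> // v.
apply: eq_Ck_on (Ck_onM oU (Ck_on_cst oU k (v * a)) (IH (a - 1))) => // t t0.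
have -> : 'D_v (fun t : R => t `^ a) t = v * 'D_1 (fun t : R => t `^ a) t.
  by rewrite !(deriveE _ (df t t0)) -[X in 'd _ _ X = _]mulr1 [LHS]linearZ.
by have [_ ->] := is_derive1_powR a t0; rewrite /= mulrA.
Qed.

(** * The Hamiltonian, its smoothness and its partial derivatives *)

Section Hamiltonian.
Context {R : realType} (d : nat) (sigma : R) (f : 'rV[R]_d -> R).
Implicit Types (z v : ext_phase_space R d) (q : 'rV[R]_d.+1) (a : 'I_d.+1).

Definition space_part q : 'rV[R]_d := rsubmx (q : 'rV_(1 + d)).

Lemma space_partE q i : space_part q 0 i = q 0 (lift ord0 i).
Proof. by rewrite mxE; congr (q _ _); exact: val_inj. Qed.

Lemma space_part_delta i :
  space_part (delta_mx 0 (lift ord0 i)) = delta_mx 0 i.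
Proof.
by apply/rowP => j; rewrite space_partE !mxE (inj_eq lift_inj).
Qed.

Lemma space_part_delta0 : space_part (delta_mx 0 ord0) = 0.
Proof.
apply/rowP => j.
by rewrite space_partE !mxE eqxx eq_sym (negbTE (neq_lift _ _)).
Qed.

Definition position z : 'rV[R]_d := space_part z.1.1.

Definition momentum a z : R := z.1.2 0 a.

Definition time z : R := z.2.

Lemma position_linear : linear position.
Proof. by move=> c y z; apply/rowP => i; rewrite !mxE. Qed.

Lemma momentum_linear a : linear (momentum a).
Proof. by move=> c y z; rewrite /momentum /= !mxE. Qed.

Lemma time_linear : linear time. Proof. by []. Qed.

Lemma continuous_position : continuous position.
Proof.
move=> z; apply: (@continuous_comp _ _ _ (fun z => z.1.1) space_part).
  by apply: (@continuous_comp _ _ _ fst fst); exact: cvg_fst.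
exact: (@continuous_rsubmx R 1 1 d).
Qed.

Lemma continuous_momentum a : continuous (momentum a).
Proof.
move=> z; apply: (@continuous_comp _ _ _ (fun z => z.1.2)
  (fun p : 'rV[R]_d.+1 => p 0 a)).
  by apply: (@continuous_comp _ _ _ fst snd); [exact: cvg_fst|exact: cvg_snd].
exact: coord_continuous.
Qed.

Lemma continuous_time : continuous time.
Proof. by move=> z; exact: cvg_snd. Qed.

Lemma open_ham_domain : open (@ham_domain R d).
Proof.
have -> : @ham_domain R d =
    momentum ord0 @^-1` [set x | x != 0] `&` time @^-1` [set t | 0 < t] by [].
apply: openI; apply: open_comp.
- by move=> z _; exact: continuous_momentum.
- exact: open_neq.
- by move=> z _; exact: continuous_time.
- exact: open_gt.
Qed.

(** Written without points, as sums and products of composites with the linear maps [position],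
    [momentum] and [time], so that the closure lemmas and the inference of derivatives apply
    directly. *)
Definition zhang_ham : ext_phase_space R d -> R :=
  cst 2^-1 * ((fun t : R => t `^ (- (2 * sigma + 1))) \o time)
    * (\sum_(i < d) momentum (lift ord0 i) * momentum (lift ord0 i))
  + cst (sigma ^+ 2) * ((fun t : R => t `^ (3 * sigma - 1)) \o time)
    * (f \o position).

Lemma smooth_zhang_ham :
  smooth_on setT f -> smooth_on (@ham_domain R d) zhang_ham.
Proof.
move=> hf k; have oU := open_ham_domain.
have Cpow r : Ck_on k (@ham_domain R d) ((fun t : R => t `^ r) \o time).
  apply: (Ck_on_comp_linear time_linear continuous_time oU _
    (smooth_on_powR r k)).
  by move=> z [].
have Cmom a : Ck_on k (@ham_domain R d) (momentum a).
  exact: (Ck_on_comp_linear (momentum_linear a) (continuous_momentum (a := a))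
    oU (fun _ _ => I) (Ck_on_id k)).
have Cpot : Ck_on k (@ham_domain R d) (f \o position).
  exact: (Ck_on_comp_linear position_linear continuous_position oU
    (fun _ _ => I) (hf k)).
apply: Ck_onD => //; apply: Ck_onM => //.
- by apply: Ck_onM => //; exact: Ck_on_cst.
- by apply: Ck_on_sum => // i; exact: Ck_onM.
- by apply: Ck_onM => //; exact: Ck_on_cst.
Qed.

Hypothesis df : forall x, differentiable f x.

(** Directions without time component cover all the partial derivatives in the canonical equations;
    along them the powers of time behave as constants. *)
Lemma derive_zhang_ham z v : 0 < time z -> time v = 0 ->
  'D_v zhang_ham z =
    time z `^ (- (2 * sigma + 1))
      * (\sum_(i < d) momentum (lift ord0 i) z * momentum (lift ord0 i) v)
    + sigma ^+ 2 * time z `^ (3 * sigma - 1) * 'D_(position v) f (position z).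
Proof.
move=> z0 v0.
have Dpow r : is_derive z v ((fun t : R => t `^ r) \o time) 0.
  have dpow : differentiable (fun t : R => t `^ r) (time z).
    by apply/derivable1_diffP/derivable_powR; rewrite in_itv/= andbT.
  have := is_derive_comp_linear time_linear continuous_time v dpow.
  by rewrite v0 derive0.
have Dmom a : is_derive z v (momentum a) (momentum a v).
  exact: is_derive_linear (momentum_linear a)
    (continuous_momentum (a := a)) _ _.
have Dpot : is_derive z v (f \o position) ('D_(position v) f (position z)).
  exact: (is_derive_comp_linear position_linear continuous_position v (df _)).
rewrite /zhang_ham derive_val.
rewrite !(scaler0, addr0) !fctE/=; congr (_ + _).
(* Each square contributes twice the same product, and this 2 cancels the factor 1/2 of the kinetic
   term. *)
under eq_bigr do rewrite -mulr2n -mulr_natl.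
by rewrite -mulr_sumr [LHS]mulrACA mulVf ?pnatr_eq0// mul1r.
Qed.

Lemma dHdq_zhang_ham0 z : 0 < time z -> dHdq zhang_ham ord0 z = 0.
Proof.
move=> z0; rewrite /dHdq derive_zhang_ham// big1 ?mulr0 ?add0r => [|i _].
  by rewrite /position space_part_delta0 derive0 mulr0.
by rewrite [momentum _ (_, _)]mxE mulr0.
Qed.

Lemma dHdq_zhang_ham z i : 0 < time z ->
  dHdq zhang_ham (lift ord0 i) z =
    sigma ^+ 2 * time z `^ (3 * sigma - 1) * grad f (position z) 0 i.
Proof.
move=> z0; rewrite /dHdq derive_zhang_ham// big1 ?mulr0 ?add0r => [|j _].
  by rewrite /position space_part_delta mxE.
by rewrite [momentum _ (_, _)]mxE mulr0.
Qed.

Lemma dHdp_zhang_ham0 z : 0 < time z -> dHdp zhang_ham ord0 z = 0.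
Proof.
move=> z0; rewrite /dHdp derive_zhang_ham// big1 ?mulr0 ?add0r => [|i _].
  by rewrite [position (_, _)](raddf0 rsubmx) derive0 mulr0.
by rewrite [momentum _ (_, _)]mxE eq_sym (negbTE (neq_lift _ _)) andbF mulr0.
Qed.

Lemma dHdp_zhang_ham z i : 0 < time z ->
  dHdp zhang_ham (lift ord0 i) z =
    time z `^ (- (2 * sigma + 1)) * momentum (lift ord0 i) z.
Proof.
move=> z0; rewrite /dHdp derive_zhang_ham//.
rewrite [position (_, _)](raddf0 rsubmx) derive0 mulr0 addr0; congr (_ * _).
rewrite (bigD1 i)//= big1 ?addr0 => [|j ji].
  by rewrite [momentum _ (_, _)]mxE !eqxx mulr1.
by rewrite [momentum _ (_, _)]mxE (inj_eq lift_inj) (negbTE ji) andbF mulr0.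
Qed.

End Hamiltonian.

(** * Derivatives of curves, coordinate by coordinate *)

Lemma is_derive_rowP {R : realType} {n} (M : R -> 'rV[R]_n) (t : R)
    (dM : 'I_n -> R) :
  (forall j, is_derive t 1 (fun s => M s 0 j) (dM j)) <->
  derivable M t 1 /\ forall j, derive1 M t 0 j = dM j.
Proof.
split=> [DM|[DM dE] j].
  have DMt : derivable M t 1
    by apply/derivable_mxP => i j; rewrite ord1; case: (DM j).
  split=> // j; rewrite derive1E derive_mx// mxE; by case: (DM j).
split; first exact: (derivable_mxP _ _ _).1.
by rewrite -dE derive1E derive_mx// mxE.
Qed.

Lemma is_derive_powR_mul {R : realType} (r : R) (g : R -> R) (t dg : R) :
  0 < t -> is_derive t 1 g dg ->
  is_derive t 1 (fun s => s `^ r * g s) (t `^ r * (dg + r / t * g t)).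
Proof.
move=> t0 Dg; have Dp := is_derive1_powR r t0; have tN0 := lt0r_neq0 t0.
apply: is_derive_eq (is_deriveM Dp Dg) _.
rewrite powRB ?tN0 ?implybT// powRr1 ?ltW// /GRing.scale /=.
by field; rewrite gt_eqF.
Qed.

Definition prepend {R : realType} {d} (c : R) (v : 'rV[R]_d) : 'rV[R]_d.+1 :=
  \row_a oapp (v 0) c (unlift ord0 a).

Lemma prepend0 {R : realType} d (c : R) (v : 'rV_d) : prepend c v 0 ord0 = c.
Proof. by rewrite mxE unlift_none. Qed.

Lemma prependS {R : realType} d (c : R) (v : 'rV_d) i :
  prepend c v 0 (lift ord0 i) = v 0 i.
Proof. by rewrite mxE liftK. Qed.

(** Zhang's equation solved for the second derivative, in coordinates, ready for comparison with the
    canonical equations. *)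
Lemma zhang_solutionP {R : realType} d (sigma : R) (f : 'rV[R]_d -> R) J x :
  zhang_solution sigma f J x <-> forall t, J t ->
    derivable x t 1 /\ forall i,
    is_derive t 1 (fun s => derive1 x s 0 i)
      (- ((2 * sigma + 1) / t * derive1 x t 0 i
          + sigma ^+ 2 * t `^ (sigma - 2) * grad f (x t) 0 i)).
Proof.
split=> xs t Jt.
  have [dx ddx xE] := xs t Jt; split=> //; apply/is_derive_rowP; split=> // i.
  apply/eqP; rewrite -addr_eq0 addrA; apply/eqP.
  by have := congr1 (fun M : 'rV_d => M 0 i) xE; rewrite !mxE.
have [dx /is_derive_rowP[ddx xE]] := xs t Jt; split=> //.
by apply/rowP => i; rewrite !mxE xE !mxE -addrA addNr.
Qed.

(** * Correspondence between the two kinds of solutions *)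

Section equivalence.
Context {R : realType} (d : nat) (sigma : R) (f : 'rV[R]_d -> R).
Hypothesis df : forall x, differentiable f x.
Variable J : set R.
Hypothesis tJ : time_interval J.

Lemma zhang_canonical x : zhang_solution sigma f J x ->
  canonical_solution (zhang_ham sigma f) J
    (fun t => prepend 0 (x t))
    (fun t => prepend 1 (t `^ (2 * sigma + 1) *: derive1 x t)).
Proof.
have [oJ _ J0] := tJ; move=> /zhang_solutionP xs t Jt.
have [dx Dx'] := xs t Jt; have t0 : 0 < t := J0 t Jt.
set q := fun t => prepend 0 (x t).
set p := fun t => prepend 1 (t `^ (2 * sigma + 1) *: derive1 x t).
have pE s i : p s 0 (lift ord0 i) = s `^ (2 * sigma + 1) * derive1 x s 0 i.
  by rewrite prependS mxE.
have posE : position (q t, p t, t) = x t.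
  by apply/rowP => i; rewrite space_partE prependS.
have [dq qH] : derivable q t 1 /\ forall a,
    derive1 q t 0 a = dHdp (zhang_ham sigma f) a (q t, p t, t).
  apply/is_derive_rowP => a; case: (unliftP ord0 a) => [i|] ->.
    (* The power of [t] in the velocity equation cancels the one in [p], leaving the velocity of
       [x]. *)
    rewrite dHdp_zhang_ham//= /momentum/= pE powRN mulKf ?gt_eqF ?powR_gt0//.
    under eq_fun do rewrite prependS.
    by move: i; apply/is_derive_rowP.
  rewrite dHdp_zhang_ham0//; under eq_fun do rewrite prepend0.
  exact: is_derive_cst.
have [dp pH] : derivable p t 1 /\ forall a,
    derive1 p t 0 a = - dHdq (zhang_ham sigma f) a (q t, p t, t).
  apply/is_derive_rowP => a; case: (unliftP ord0 a) => [i|] ->.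
    under eq_fun do rewrite pE.
    apply: is_derive_eq (is_derive_powR_mul _ t0 (Dx' i)) _.
    rewrite dHdq_zhang_ham// posE /time/=.
    have -> : 3 * sigma - 1 = (2 * sigma + 1) + (sigma - 2) by ring.
    by rewrite [_ `^ (_ + (sigma - 2))]powRD ?lt0r_neq0 ?implybT//; ring.
  rewrite dHdq_zhang_ham0// oppr0; under eq_fun do rewrite prepend0.
  exact: is_derive_cst.
by split=> //; split=> //=; rewrite prepend0 oner_neq0.
Qed.

(** The first canonical equation expresses the velocity through [p]; differentiating this and
    inserting the second one eliminates [p]. *)
Lemma canonical_zhang q p (x : R -> 'rV_d) :
  canonical_solution (zhang_ham sigma f) J q p ->
  (forall t, J t -> forall i, x t 0 i = q t 0 (lift ord0 i)) ->
  zhang_solution sigma f J x.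
Proof.
have [oJ _ J0] := tJ; move=> qps xq; apply/zhang_solutionP.
have Dx t : J t -> derivable x t 1 /\ forall i,
    derive1 x t 0 i = t `^ (- (2 * sigma + 1)) * p t 0 (lift ord0 i).
  move=> Jt; have [_ dq _ H] := qps t Jt; have t0 : 0 < t := J0 t Jt.
  apply/is_derive_rowP => i.
  (* [x] is tied to [q] on [J] only; openness of [J] makes this enough for derivatives. *)
  apply: (@near_eq_is_derive _ _ _ (fun s => q s 0 (lift ord0 i))).
    by apply: (near_eq_open oJ _ Jt) => s Js; rewrite xq.
  have /is_derive_rowP/(_ (lift ord0 i)) := conj dq (fun a => (H a).1).
  by rewrite dHdp_zhang_ham.
move=> t Jt; have [dx x'E] := Dx t Jt; split=> // i.
have [_ _ dp H] := qps t Jt; have t0 : 0 < t := J0 t Jt.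
(* The formula for the velocity holds on all of [J], hence near [t], and may be differentiated once
   more. *)
apply: (@near_eq_is_derive _ _ _
  (fun s => s `^ (- (2 * sigma + 1)) * p s 0 (lift ord0 i))).
  by apply: (near_eq_open oJ _ Jt) => s Js; have [_ ->] := Dx s Js.
have /is_derive_rowP/(_ (lift ord0 i)) Dp := conj dp (fun a => (H a).2).
apply: is_derive_eq (is_derive_powR_mul _ t0 Dp) _.
have posE : position (q t, p t, t) = x t.
  by apply/rowP => j; rewrite space_partE xq.
rewrite dHdq_zhang_ham// posE x'E /time/=.
have -> : sigma - 2 = - (2 * sigma + 1) + (3 * sigma - 1) by ring.
rewrite [in RHS]powRD ?lt0r_neq0 ?implybT//.
by field; rewrite gt_eqF.
Qed.

End equivalence.

Theorem theorem2p1 (R : realType) (d : nat) (hd : (1 <= d)%N)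
    (sigma : R) (hsigma : 2 <= sigma)
    (f : 'rV[R]_d -> R) (hf : smooth_on setT f) :
  exists H : ext_phase_space R d -> R,
    smooth_on (@ham_domain R d) H /\
    forall (J : set R), time_interval J ->
    forall (x : R -> 'rV[R]_d),
      zhang_solution sigma f J x <->
      exists q p : R -> 'rV[R]_d.+1,
        canonical_solution H J q p /\
        forall t, J t -> forall i : 'I_d, x t 0 i = q t 0 (lift ord0 i).
Proof.
have df x : differentiable f x by have [+ _] := hf 1%N; exact.
exists (zhang_ham sigma f); split; first exact: smooth_zhang_ham.
move=> J tJ x; split=> [xs|[q [p [qps xq]]]]; last first.
  exact: canonical_zhang qps xq.
do 2 eexists; split; first exact: zhang_canonical xs.
by move=> t _ i; rewrite prependS.
Qed.
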